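(* Let $S$ be a cancellative commutative feebly compact topological monoid with open shifts satisfying the first axiom of countability. Then $\mathcal{C}_r(S)$ is a compact metrizable topological group. Moreover, the following statements hold: (i) if $S$ is $T_2$, then $S$ is a paratopological group; (ii) if $S$ is regular, then $S$ is a compact metrizable topological group.
   Context: A topological monoid is a monoid $S$ with a topology (no separation axiom assumed unless stated) such that the operation $S\times S\to S$ is jointly continuous. It has open shifts if for every $a\in S$ and every open $U\subseteq S$ the sets $aU$ and $Ua$ are open in $S$. A paratopological group is a group with a topology making the multiplication jointly continuous; it is a topological group if inversion is also continuous. Saying that a topological monoid ''is a paratopological (topological) group'' means that with its given operation and topology it is one. A space is feebly compact if each locally finite family of open sets in it is finite. Regular means $T_1$ and points can be separated from closed sets not containing them by disjoint open sets. For a topological space $X$, $\mathcal C_r(X)$ denotes the regular reflection of $X$: a regular space, unique up to homeomorphism, together with a continuous surjection $\varphi_{(X,\mathcal C_r)}\colon X\to\mathcal C_r(X)$ such that for every continuous $f\colon X\to Y$ with $Y$ regular there is a unique continuous $g\colon\mathcal C_r(X)\to Y$ with $g\circ\varphi_{(X,\mathcal C_r)}=f$. When $S$ is a topological monoid with open shifts, it is known that $\mathcal C_r(S)$ carries a (necessarily unique) monoid operation making $\varphi_{(S,\mathcal C_r)}$ a homomorphism; $\mathcal C_r(S)$ is considered with this operation. *)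

(* Defs.v *)
From HB Require Import structures.
From mathcomp Require Import all_boot all_order all_algebra.
From mathcomp Require Import all_classical all_reals all_analysis.

Set Implicit Arguments.
Unset Strict Implicit.
Unset Printing Implicit Defensive.

Local Open Scope classical_set_scope.
Local Open Scope group_scope.

(* No compatibility is assumed between the operation and the topology, as in
   PreTopologicalNmodule. *)
#[short(type="preTopologicalMonoidType")]
HB.structure Definition PreTopologicalMonoid :=
  {M of Topological M & Monoid M}.

Definition topological_monoid (S : preTopologicalMonoidType) : Prop :=
  continuous (fun p : S * S => p.1 * p.2).

Definition open_shifts (S : preTopologicalMonoidType) : Prop :=
  forall (a : S) (U : set S), open U ->
    @open S [set a * x | x in U] /\ @open S [set x * a | x in U].

Definition cancellative (S : monoidType) : Prop :=
  right_injective (@monoid.mul S) /\ left_injective (@monoid.mul S).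

Definition paratopological_group (G : preTopologicalMonoidType) : Prop :=
  topological_monoid G /\
  exists inv : G -> G, left_inverse 1 inv *%g /\ right_inverse 1 inv *%g.

Definition topological_group (G : preTopologicalMonoidType) : Prop :=
  topological_monoid G /\
  exists inv : G -> G,
    [/\ left_inverse 1 inv *%g, right_inverse 1 inv *%g & continuous inv].

Definition locally_finite (T : topologicalType) (F : set (set T)) : Prop :=
  forall x : T, exists2 U, nbhs x U &
    finite_set [set V | F V /\ V `&` U !=set0].

Definition feebly_compact (T : topologicalType) : Prop :=
  forall F : set (set T), F `<=` open -> locally_finite F -> finite_set F.

Definition first_countable (T : topologicalType) : Prop :=
  forall x : T, exists B : set (set T),
    [/\ countable B, B `<=` nbhs x &
        forall A, nbhs x A -> exists2 U, B U & U `<=` A].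

(* regular_space does not include the T1 axiom. *)
Definition T1_regular (T : topologicalType) : Prop :=
  @accessible_space T /\ @regular_space T.

Definition metrizable (R : realType) (T : topologicalType) : Prop :=
  exists (M : metricType R) (f : T -> M) (g : M -> T),
    [/\ cancel f g, cancel g f, continuous f & continuous g].

Definition compact_metrizable_topological_group
    (R : realType) (G : preTopologicalMonoidType) : Prop :=
  [/\ compact [set: G], metrizable R G & topological_group G].

Definition regular_reflection (X C : topologicalType) (phi : X -> C) : Prop :=
  [/\ T1_regular C, continuous phi, set_surj [set: X] [set: C] phi &
      forall (Y : topologicalType) (f : X -> Y), T1_regular Y -> continuous f ->
        exists! g : C -> Y, continuous g /\ g \o phi = f].

Lemma regular_reflection_mul (S : preTopologicalMonoidType)
    (C : topologicalType) (phi : S -> C) :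
  topological_monoid S -> regular_reflection phi ->
  exists2 op : C -> C -> C, {morph phi : x y / x * y >-> op x y} &
    [/\ associative op, left_id (phi 1) op & right_id (phi 1) op].
Proof.
move=> ctsM [regC ctsphi surj univ].
have shiftr b x y : phi x = phi y -> phi (x * b) = phi (y * b).
  move=> xy.
  have [|g [[_ gE] _]] := univ C (fun x => phi (x * b)) regC.
    move=> z.
    apply: (@continuous_comp _ _ _ (fun x => x * b) phi); last exact: ctsphi.
    apply: (@continuous_comp _ _ _ (fun x => (x, b)) (fun p => p.1 * p.2)).
      by apply: cvg_pair => /=; [exact: cvg_id|exact: cvg_cst].
    exact: ctsM.
  by rewrite -[LHS](congr1 (@^~ x) gE) -[RHS](congr1 (@^~ y) gE) /= xy.
have shiftl a x y : phi x = phi y -> phi (a * x) = phi (a * y).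
  move=> xy.
  have [|g [[_ gE] _]] := univ C (fun x => phi (a * x)) regC.
    move=> z.
    apply: (@continuous_comp _ _ _ (fun x => a * x) phi); last exact: ctsphi.
    apply: (@continuous_comp _ _ _ (fun x => (a, x)) (fun p => p.1 * p.2)).
      by apply: cvg_pair => /=; [exact: cvg_cst|exact: cvg_id].
    exact: ctsM.
  by rewrite -[LHS](congr1 (@^~ x) gE) -[RHS](congr1 (@^~ y) gE) /= xy.
have /choice[s sK] : forall c, exists x, phi x = c.
  by move=> c; have [x _ <-] := surj c I; exists x.
pose op c d := phi (s c * s d).
have opE x y : phi (x * y) = op (phi x) (phi y).
  rewrite /op -(shiftr _ (s (phi x)) x) ?sK//.
  by apply: shiftl; rewrite sK.
exists op => //; split.
- by move=> x y z; rewrite -[x]sK -[y]sK -[z]sK -!opE mulgA.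
- by move=> x; rewrite -[x]sK -opE mul1g.
- by move=> x; rewrite -[x]sK -opE mulg1.
Qed.

(* The open sets forming the finest topology coarser than that of X in which
   points and closed sets are separated by open sets. *)
Definition reflection_open (X : topologicalType) : set (set X) :=
  [set U | exists P : set (set X), [/\ P `<=` open, P U &
    forall A x, P A -> A x -> exists V W,
      [/\ P V, P W, V x, V `&` W = set0 & ~` A `<=` W]]].

Section reflection_exists.
Context (X : topologicalType).
Local Notation P := (@reflection_open X).

Let sep A x : P A -> A x -> exists V W,
  [/\ P V, P W, V x, V `&` W = set0 & ~` A `<=` W].
Proof.
move=> [Q [Qo QA Qsep]] /(Qsep _ _ QA)[V [W [QV QW Vx VW AW]]].
by exists V, W; split => //; exists Q.
Qed.

Let Popen A : P A -> open A.
Proof. by move=> [Q [Qo QA _]]; exact: Qo. Qed.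

Let P0 : P set0.
Proof. by exists [set set0]; split => // [_ ->|A x ->]; [exact: open0|]. Qed.

Let PT : P setT.
Proof.
exists [set set0; setT]; split; [|by right|].
  by move=> _ [->|->]; [exact: open0|exact: openT].
move=> A x [->//|->] _; exists setT, set0; split; [by right|by left|by []| |].
  by rewrite setI0.
by rewrite setCT.
Qed.

Let PU I (f : I -> set X) : (forall i, P (f i)) -> P (\bigcup_i f i).
Proof.
move=> Pf; exists (P `|` [set \bigcup_i f i]); split; [|by right|].
  move=> A [/Popen//|->]; apply: bigcup_open => i _; exact: Popen.
move=> A x [PA Ax|-> [i _ fix_]].
  by have [V [W [PV PW Vx VW AW]]] := sep PA Ax; exists V, W; split => //; left.
have [V [W [PV PW Vx VW AW]]] := sep (Pf i) fix_.
exists V, W; split => //; [by left|by left|].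
by apply: subset_trans AW; apply: subsetC => y fy; exists i.
Qed.

Let PU2 A B : P A -> P B -> P (A `|` B).
Proof.
move=> PA PB; rewrite (_ : _ `|` _ = \bigcup_b (if b then A else B)).
  by apply: PU => -[].
apply/seteqP; split => [x [Ax|Bx]|x [[] _ ?]]; [by exists true|by exists false|
  by left|by right].
Qed.

Let PI A B : P A -> P B -> P (A `&` B).
Proof.
move=> PA PB.
exists [set C | exists A B, [/\ P A, P B & C = A `&` B]]; split.
- by move=> _ [A' [B' [/Popen ? /Popen ? ->]]]; exact: openI.
- by exists A, B.
- move=> _ x [A' [B' [PA' PB' ->]]] [A'x B'x].
  have [V [W [PV PW Vx VW AW]]] := sep PA' A'x.
  have [V' [W' [PV' PW' Vx' VW' BW]]] := sep PB' B'x.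
  exists (V `&` V'), (W `|` W'); split => //; first by exists V, V'.
  + by exists (W `|` W'), setT; rewrite setIT; split => //; exact: PU2.
  + rewrite -subset0 => y [[Vy V'y] [Wy|W'y]].
      by rewrite -VW.
    by rewrite -VW'.
  + by rewrite setCI; exact: setUSS.
Qed.

Let cls (x : X) : set (set X) := [set U | P U /\ U x].
Definition reflection_type := set_type (range cls).

Local Notation C := reflection_type.

Let phi (x : X) : C := SigSub (mem_set (imageT cls x)).

Let phiE x y : phi x = phi y <-> (forall U, P U -> U x <-> U y).
Proof.
split=> [/(congr1 val)/= xy U PU'|xy].
  have /seteqP[h1 h2] := xy.
  split=> Ux; [have [] // := h1 U (conj PU' Ux)|by have [] := h2 U (conj PU' Ux)].
apply/val_inj => /=; apply/seteqP; split => U [PU' Ux]; split => //.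
  exact/(xy U PU').
exact/(xy U PU').
Qed.

Let phi_surj c : exists x, phi x = c.
Proof.
case: c => c cP; have [x _ xc] := set_mem cP.
by exists x; apply/val_inj.
Qed.

Let opC : set (set C) := [set O | P (phi @^-1` O)].

Let opCT : opC setT. Proof. exact: PT. Qed.
Let opCI A B : opC A -> opC B -> opC (A `&` B). Proof. exact: PI. Qed.
Let opCU (I : Type) (f : I -> set C) :
  (forall i, opC (f i)) -> opC (\bigcup_i f i).
Proof. by move=> h; rewrite /opC /= preimage_bigcup; exact: PU. Qed.

HB.instance Definition _ := Choice.on C.
HB.instance Definition _ := isOpenTopological.Build C opCT opCI opCU.

Let openCE (O : set C) : open O = P (phi @^-1` O).
Proof. by []. Qed.

Let preim_img U : P U -> phi @^-1` (phi @` U) = U.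
Proof.
move=> PU'; apply/seteqP; split => [x [y Uy /phiE yx]|x Ux]; last by exists x.
exact/(yx U PU').
Qed.

Let open_img U : P U -> open (phi @` U).
Proof. by move=> PU'; rewrite openCE preim_img. Qed.

Lemma regular_reflection_exists :
  exists (D : topologicalType) (psi : X -> D), regular_reflection psi.
Proof.
exists C, phi; split.
- split.
  + move=> c d /eqP; have [x <-] := phi_surj c; have [y <-] := phi_surj d.
    move=> xy; have [U [PU' UxNUy]] : exists U, P U /\ ~ (U x <-> U y).
      apply: contrapT => h; apply/xy/phiE => U PU'; apply: contrapT => UxNUy.
      by apply: h; exists U.
    have [Ux|NUx] := pselect (U x).
      exists (phi @` U); rewrite !inE; split; [exact: open_img|by exists x|].
      move=> Uy; apply: UxNUy; split => // _; move: Uy.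
      by rewrite -[_ (phi y)]/((phi @^-1` (phi @` U)) y) preim_img.
    have Uy : U y by apply: contrapT => NUy; apply: UxNUy; split.
    have [V [W [PV PW Vy VW UW]]] := sep PU' Uy.
    exists (phi @` W); rewrite !inE; split; [exact: open_img| |].
      by exists x => //; exact: UW.
    move=> Wy; have : (V `&` W) y.
      by split => //; rewrite -(preim_img PW).
    by rewrite VW.
  + move=> c A; rewrite {1}nbhsE => -[B [oB Bc] BA].
    have [x xc] := phi_surj c; subst c.
    have [V [W [PV PW Vx VW BW]]] := sep oB Bc.
    exists (phi @` V) => /=.
      by apply: open_nbhs_nbhs; split; [exact: open_img|exists x].
    apply: subset_trans BA => d; have [y <-] := phi_surj d => clVy.
    apply: contrapT => NBy.
    have [_ [[v Vv <-]]] : (phi @` V `&` phi @` W) !=set0.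
      apply: clVy; apply: open_nbhs_nbhs; split; first exact: open_img.
      by exists y => //; exact: BW.
    rewrite -[_ (phi v)]/((phi @^-1` (phi @` W)) v) preim_img// => Wv.
    by have : (V `&` W) v by []; rewrite VW.
- by apply/continuousP => O; rewrite openCE; exact: Popen.
- by move=> c _; have [x <-] := phi_surj c; exists x.
- move=> Y f [T1Y regY] ctsf.
  have Pf O : open O -> P (f @^-1` O).
    move=> oO; exists [set f @^-1` O | O in open]; split; last first.
    + move=> _ x [A oA <-] Afx.
      have /regY[B Bfx BA] : nbhs (f x) A by exact: open_nbhs_nbhs.
      exists (f @^-1` B°), (f @^-1` (~` closure B)); split => //.
      * by exists B° => //; exact: open_interior.
      * by exists (~` closure B) => //; exact/closed_openC/closed_closure.
      * rewrite -preimage_setI -subset0 => y [/interior_subset By].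
        by apply; exact: subset_closure.
      * by move=> y NAy /BA.
    + by exists O.
    + by move=> _ [A oA <-]; move/continuousP: ctsf; exact.
  have fphi x y : phi x = phi y -> f x = f y.
    move=> /phiE xy; apply: contrapT => /eqP /T1Y [A [oA]]; rewrite !inE.
    by move=> Afx; apply; apply/(xy _ (Pf _ oA)).
  have /choice[s sK] := phi_surj.
  exists (f \o s); split.
    split; last by apply/funext => x /=; apply: fphi; rewrite sK.
    apply/continuousP => O oO; rewrite openCE.
    rewrite (_ : _ @^-1` _ = f @^-1` O); first exact: Pf.
    by apply/seteqP; split => x /=; rewrite (fphi (s (phi x)) x) ?sK.
  move=> g [_ gE]; apply/funext => c /=; have [x <-] := phi_surj c.
  by rewrite -gE /= sK.
Qed.

End reflection_exists.

(* Main.v *)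
Require Import Defs.
From HB Require Import structures.
From mathcomp Require Import all_boot all_order all_algebra.
From mathcomp Require Import all_classical all_reals all_analysis.

(** For a neighbourhood [V] of [1] call [x] and [y] [V]-near when [x V] meets
[y V]. Because [S] is commutative and the operation is continuous, these
relations are the base of a uniformity on [S], invariant under multiplication,
countably based and coarser than the given topology. Were [S] a group, it
would be the finest group topology coarser than the given one. Everything
follows from four facts about the resulting space, [shift_space].

- Every [x] has a quasi-inverse: some [y] such that [x y] and [1] have no
  disjoint neighbourhoods ([quasi_inverse]). Feeble compactness makes the
  powers of [x] accumulate, up to small factors, and cancelling two of them
  shows that [1] is nearly a multiple of [x]; a second accumulation argument,
  applied to the approximate inverses, yields [y].
- If [x] and [y] are [V]-near for a small [V], then [y] is in the closure of
  [x U] ([shift_ent_closure]). Hence continuous maps from [S] to regular spaces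
  remain continuous on [shift_space]. This is where feeble compactness replaces
  the missing continuity of inversion: it rules out a decreasing sequence of
  open sets [O_n] with open [D_n] inside [O_n] that avoid [O_(n+1) W]
  ([subset_closure_shift]).
- [shift_space] is compact ([shift_space_compact]).
- Being a uniform space, [shift_space] has enough continuous real functions to
  define its neighbourhoods; they are continuous on [S] and so factor through
  the regular reflection.

Consequently the reflection [phi : S -> C] induces exactly the topology of
[shift_space], and [C] is its Kolmogorov quotient: it is compact, it is metrized
by any pseudometric for the countable uniformity, its multiplication is
continuous, and quasi-inverses become inverses that depend continuously on the
point. If [S] is Hausdorff, quasi-inverses are inverses in [S] itself, and if [S]
is regular, the identity is a regular reflection. *)

(** * Feebly compact and first countable spaces *)

Section Spaces.
Set Implicit Arguments.
Unset Strict Implicit.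
Unset Printing Implicit Defensive.
Local Open Scope classical_set_scope.

(** Indexing by a sequence rather than by a set lets the same open set occur
several times: a sequence without accumulation point has a locally finite, hence
finite, range, and then one nonempty term recurs infinitely often, so that its
own points are accumulation points. *)
Lemma feebly_compact_accumulation (T : topologicalType) (F : nat -> set T) :
  feebly_compact T -> (forall n, open (F n)) -> (forall n, F n !=set0) ->
  exists a : T, forall N, nbhs a N -> forall n, exists2 m, (n <= m)%N & F m `&` N !=set0.
Proof.
move=> fcT oF F0; apply: contrapT => noacc.
have escape (a : T) : exists2 N, nbhs a N &
    exists n, forall m, (n <= m)%N -> F m `&` N = set0.
  apply: contrapT => h; apply: noacc; exists a => N Na n.
  apply: contrapT => h'; apply: h; exists N => //; exists n => m nm.
  by apply: contrapT => /eqP/set0P ?; apply: h'; exists m.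
have lfF : locally_finite (range F).
  move=> a; have [N Na [n nF]] := escape a; exists N => //.
  apply: (@sub_finite_set _ _ (F @` `I_n)); last first.
    exact/finite_image/finite_II.
  move=> _ [[m _ <-] FmN]; exists m => //=; rewrite ltnNge; apply/negP => nm.
  by move: FmN; rewrite nF// => /set0P; rewrite eqxx.
have finF : finite_set (range F) by apply: fcT => // _ [m _ <-].
have [V Vrec] : exists V, forall n, exists2 m, (n <= m)%N & F m = V.
  apply: contrapT => h.
  have /choice[b bP] V : exists n, forall m, (n <= m)%N -> F m <> V.
    apply: contrapT => h'; apply: h; exists V => n; apply: contrapT => h''.
    by apply: h'; exists n => m nm FmV; apply: h''; exists m.
  have /finite_seqP[X XE] := finF.
  pose k := \max_(V <- X) b V.
  have : range F (F k) by exists k.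
  rewrite XE /= => FkX.
  by apply: (bP (F k) k) => //; rewrite /k (leq_bigmax_seq (F k)).
have [m _ FmV] := Vrec 0%N; have [a] := F0 m; rewrite FmV => Va.
have [N Na [n nF]] := escape a; have [m' nm' Fm'V] := Vrec n.
have : (F m' `&` N) a by split; [rewrite Fm'V|exact: nbhs_singleton].
by rewrite nF.
Qed.

Lemma first_countable_base (T : topologicalType) (x : T) : first_countable T ->
  exists U : nat -> set T, [/\ forall n, nbhs x (U n),
    forall m n, (m <= n)%N -> U n `<=` U m &
    forall A, nbhs x A -> exists n, U n `<=` A].
Proof.
move=> /(_ x)[B [cB Bx xB]].
have [V0 BV0 _] := xB _ (@filterT _ _ (nbhs_filter x)).
have /pfcard_geP[B0|/unsquash f] := cB; first by move: BV0; rewrite B0.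
exists (fun n => \bigcap_(i in `I_n.+1) f i); split.
- move=> n; rewrite bigcap_mkord; elim/big_ind: _ => [|A A'|i _].
  + exact: filterT.
  + exact: filterI.
  + by apply: Bx; exact: funS.
- move=> m n mn y Uy i /= im; apply: Uy => /=.
  by apply: leq_trans im _; rewrite ltnS.
- move=> A /xB[V BV VA]; have [n _ fn] := @surj _ _ _ _ f _ BV.
  by exists n; apply: subset_trans VA; rewrite -fn => y; apply => /=.
Qed.

End Spaces.

(** * Accumulation in feebly compact monoids with open shifts *)

Section Monoids.
Set Implicit Arguments.
Unset Strict Implicit.
Unset Printing Implicit Defensive.
Local Open Scope classical_set_scope.
Local Open Scope group_scope.

Context (S : preTopologicalMonoidType).
Hypothesis ctsM : topological_monoid S.

Lemma nbhs_mul (x y : S) (N : set S) : nbhs (x * y) N ->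
  exists A B, [/\ nbhs x A, nbhs y B & forall a b, A a -> B b -> N (a * b)].
Proof.
move=> /(@ctsM (x, y))[[A B] /= [xA yB] ABN]; exists A, B; split => // a b Aa Bb.
exact: (ABN (a, b)).
Qed.

Lemma nbhs_mulr (x y : S) (N : set S) : nbhs (x * y) N -> nbhs y [set z | N (x * z)].
Proof.
move=> /nbhs_mul[A [B [/nbhs_singleton Ax yB AN]]].
by apply: filterS yB => z Bz; exact: AN.
Qed.

Lemma nbhs_mull (x y : S) (N : set S) : nbhs (x * y) N -> nbhs x [set z | N (z * y)].
Proof.
move=> /nbhs_mul[A [B [xA /nbhs_singleton By AN]]].
by apply: filterS xA => z Az; exact: AN.
Qed.

Lemma nbhs_mul1 (x : S) (N : set S) : nbhs x N -> nbhs 1 [set z | N (x * z)].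
Proof. by move=> xN; apply: nbhs_mulr; rewrite mulg1. Qed.

Lemma nbhs1_sqr (V : set S) : nbhs 1 V ->
  exists W, [/\ nbhs 1 W, W `<=` V & forall a b, W a -> W b -> V (a * b)].
Proof.
move=> V1; have /nbhs_mul[A [B [A1 B1 ABV]]] : nbhs (1 * 1 : S) V by rewrite mulg1.
exists (A `&` B); split; first exact: filterI.
  by move=> a [Aa _]; rewrite -[a]mulg1; apply: ABV => //; exact: nbhs_singleton.
by move=> a b [Aa _] [_ Bb]; exact: ABV.
Qed.

Hypothesis opS : open_shifts S.

Lemma open_shift (x : S) (V : set S) : open [set x * v | v in V°].
Proof. by have [] := opS x (open_interior V). Qed.

Lemma shift_neq0 (x : S) (V : set S) : nbhs 1 V -> [set x * v | v in V°] !=set0.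
Proof. by move=> V1; exists (x * 1), 1. Qed.

Lemma nbhs_shift (x : S) (V : set S) : nbhs 1 V -> nbhs x [set x * v | v in V].
Proof.
move=> V1; apply: (@filterS _ _ _ [set x * v | v in V°]).
  by move=> _ [v Vv <-]; exists v => //; exact: interior_subset.
apply: open_nbhs_nbhs; split; first exact: open_shift.
by exists 1; rewrite ?mulg1.
Qed.

Hypothesis fcS : feebly_compact S.

(** Moving each term inside a prescribed neighbourhood of itself gives open
sets, so feeble compactness applies to sequences of points up to such small
right factors. *)
Lemma shift_accumulation (x : nat -> S) (V : nat -> set S) :
  (forall n, nbhs 1 (V n)) ->
  exists a, forall W, nbhs 1 W -> forall n, exists2 m, (n <= m)%N &
    exists v w, [/\ V m v, W w & x m * v = a * w].
Proof.
move=> V1; have [|n|a aP] := @feebly_compact_accumulation S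
    (fun n => [set x n * v | v in (V n)°]) fcS.
- by move=> n; exact: open_shift.
- exact: shift_neq0.
exists a => W W1 n; have [m nm [_ [[v Vv <-] [w Ww xa]]]] := aP _ (nbhs_shift a W1) n.
by exists m => //; exists v, w; split => //; exact: interior_subset.
Qed.

(** If the conclusion fails, each nonempty open [O] contains [x] and [y] with [y]
outside the closure of [x U]; then [O] contains a neighbourhood [O'] of [x] and a
neighbourhood [D] of [y] with [O' W] disjoint from [D], for a fixed [W] with
[W W] inside [U]. Iterating from [O] to [O'] gives decreasing [O_n] and sets
[D_n]. An accumulation point [y] of the [D_n] adheres to every [O_n], but some
[D_m] meets [y W], which contradicts that it avoids [O_(m+1) W]. *)
Lemma subset_closure_shift (U : set S) : nbhs 1 U ->
  exists O, [/\ open O, O !=set0 &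
    forall x, O x -> O `<=` closure [set x * u | u in U]].
Proof.
move=> U1; have [W [W1 _ WU]] := nbhs1_sqr U1; apply: contrapT => noO.
pose good (O : set S) := open O /\ O !=set0.
have step (O : set S) : exists P : set S * set S, good O ->
    [/\ good P.1, P.1 `<=` O, good P.2, P.2 `<=` O &
        forall x w, P.1 x -> W w -> ~ P.2 (x * w)].
  have [gO|nO] := pselect (good O); last by exists (O, O).
  have [x [Ox [y [Oy NUy]]]] : exists x, O x /\ exists y, O y /\
      ~ closure [set x * u | u in U] y.
    apply: contrapT => h; apply: noO; case: gO => oO O0; exists O; split=> // x Ox y Oy.
    by apply: contrapT => h'; apply: h; exists x; split=> //; exists y.
  have [oO _] := gO.
  exists (O `&` [set x * w | w in W°], O `\` closure [set x * u | u in U]).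
  move=> _; split => /=.
  - split; first by apply: openI => //; exact: open_shift.
    by exists x; split => //; exists 1; rewrite ?mulg1.
  - exact: subIsetl.
  - split; last by exists y.
    by rewrite setDE; apply: openI => //; exact/closed_openC/closed_closure.
  - exact: subDsetl.
  - move=> _ w [_ [v Wv <-]] Ww [_]; apply; apply: subset_closure.
    by exists (v * w); rewrite ?mulgA//; apply: WU => //; exact: interior_subset.
have [next nextP] := choice step.
pose O n := iter n (fun O => (next O).1) [set: S].
have gO n : good (O n).
  elim: n => [|n /nextP[]//]; split; [exact: openT|by exists 1].
have leO m n : (m <= n)%N -> O n `<=` O m.
  elim: n => [|n IHn]; first by rewrite leqn0 => /eqP ->.
  rewrite leq_eqVlt => /predU1P[->//|mn].
  by apply: subset_trans (IHn mn); have [] := nextP _ (gO n).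
pose D n := (next (O n)).2.
have DO n : D n `<=` O n by have [] := nextP _ (gO n).
have oD n : open (D n) by have [_ _ []] := nextP _ (gO n).
have DW n x w : O n.+1 x -> W w -> ~ D n (x * w) by have [_ _ _ _] := nextP _ (gO n); apply.
have [|y yD] := @feebly_compact_accumulation S D fcS oD.
  by move=> n; have [_ _ []] := nextP _ (gO n).
have [m _ [z [+ [w Ww zE]]]] := yD _ (nbhs_shift y W1) 0%N.
rewrite -{}zE {z} => Dyw.
have /nbhs_mull yN : nbhs (y * w) (D m) by exact: open_nbhs_nbhs.
have [k mk [z [Dz]]] := yD _ yN m.+1.
by apply: DW => //; apply: (leO m.+1 k mk); exact: DO.
Qed.

Hypothesis cancelS : cancellative S.

(** In a group this says that [w^-1] is in the closure of [U] when [w] is close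
to [1], which is continuity of inversion up to closure. *)
Lemma one_in_closure_shift (U : set S) : nbhs 1 U ->
  exists2 V, nbhs 1 V & forall w, V w -> closure [set w * u | u in U] 1.
Proof.
move=> /subset_closure_shift[P [oP [x Px] Pcl]].
exists [set w | P (x * w)].
  by apply: nbhs_mul1; exact: open_nbhs_nbhs.
move=> w /= Pxw N N1.
have [_ [[u Uu <-] [n Nn]]] := Pcl _ Pxw _ Px _ (nbhs_shift x N1).
rewrite -mulgA => /(cancelS.1 x) nE; exists n; split => //.
by exists u.
Qed.

Hypothesis mulC : commutative (@monoid.mul S).

Lemma mulgRAC : right_commutative (@monoid.mul S).
Proof. by move=> x y z; rewrite -mulgA (mulC y) mulgA. Qed.

(** Two powers of [x] that are close to the same point differ by a factor
close to [1]. *)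
Lemma approx_inverse (x : S) (V : set S) : nbhs 1 V ->
  exists y u v, [/\ V u, V v & x * y * u = v].
Proof.
move=> V1; have [W [W1 WV WW]] := nbhs1_sqr V1.
have [a aP] := shift_accumulation (fun n => x ^+ n) (fun _ => W1).
have [m _ [v [w [Wv Ww xmv]]]] := aP _ W1 0%N.
have [n mn [v' [w' [Wv' Ww' xnv']]]] := aP _ W1 m.+1.
(* the exponent is shifted by one to leave a factor x in front *)
exists (x ^+ (n - m.+1)), (v' * w), (v * w'); split; [exact: WW|exact: WW|].
apply: (cancelS.1 (x ^+ m)).
rewrite -expgS !mulgA -expgnDr addnS -addSn subnKC// xmv xnv'.
exact: mulgRAC.
Qed.

Hypothesis fctS : first_countable S.

(** The approximate inverses [y n], taken with precision [U n], accumulate at a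
point; continuity transfers their defining property to it, but only up to
inseparability since small factors cannot be inverted. *)
Lemma quasi_inverse (x : S) : exists y : S, cluster (nbhs (x * y)) 1.
Proof.
have [U [U1 Ule U1P]] := first_countable_base 1 fctS.
have /choice[y yP] n : exists y, exists u v, [/\ U n u, U n v & x * y * u = v].
  exact: approx_inverse.
have [b bP] := shift_accumulation y U1; exists b => A B /nbhs_mul1 A1 B1.
have [W [W1 _ WAB]] := nbhs1_sqr (filterI A1 B1).
have [n0 UW] := U1P _ W1.
have [n n0n [p [q [Unp Wq ypq]]]] := bP _ W1 n0.
have [u [v [Unu Unv xyu]]] := yP n.
have UnW z : U n z -> W z by move=> /(Ule _ _ n0n)/UW.
have [Aqu _] := WAB _ _ Wq (UnW _ Unu).
have [_ Bvp] := WAB _ _ (UnW _ Unv) (UnW _ Unp).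
exists (v * p); split => //.
suff -> : v * p = x * b * (q * u) by [].
by rewrite mulgA -(mulgA x) -ypq -xyu mulgA; exact: mulgRAC.
Qed.

End Monoids.

(** * The shift uniformity *)

Section ShiftUniformity.
Set Implicit Arguments.
Unset Strict Implicit.
Unset Printing Implicit Defensive.
Local Open Scope classical_set_scope.
Import numFieldNormedType.Exports.
Local Open Scope group_scope.

Definition shift_ent (S : monoidType) (V : set S) : set (S * S) :=
  [set p | exists v w, [/\ V v, V w & p.1 * v = p.2 * w]].

Context (S : preTopologicalMonoidType).
Hypothesis ctsM : topological_monoid S.
Hypothesis mulC : commutative (@monoid.mul S).

Lemma shift_ent_sub (V W : set S) : V `<=` W -> shift_ent V `<=` shift_ent W.
Proof. by move=> VW p [v [w [/VW ? /VW ? ?]]]; exists v, w. Qed.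

Lemma shift_ent_trans (V W : set S) (x y z : S) :
  (forall a b, W a -> W b -> V (a * b)) ->
  shift_ent W (x, y) -> shift_ent W (y, z) -> shift_ent V (x, z).
Proof.
move=> WV [v [w [Wv Ww /= xy]]] [v' [w' [Wv' Ww' /= yz]]].
exists (v * v'), (w' * w); split; [exact: WV|exact: WV|rewrite /=].
by rewrite !mulgA xy -yz; exact: mulgRAC.
Qed.

Lemma shift_ent_sym (V : set S) (x y : S) :
  shift_ent V (x, y) -> shift_ent V (y, x).
Proof. by move=> [v [w [Vv Vw /= xy]]]; exists w, v. Qed.

Lemma shift_ent_mul (V : set S) (c x y : S) :
  shift_ent V (x, y) -> shift_ent V (c * x, c * y).
Proof. by move=> [v [w [Vv Vw /= xy]]]; exists v, w; rewrite /= -!mulgA xy. Qed.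

(** The two hypotheses are arguments so that the instances below, which depend
on them, can be found from the type alone. *)
Definition shift_space : Type := let _ := ctsM in let _ := mulC in S.

HB.instance Definition _ := Choice.copy shift_space S.

Definition shift_entourage : set_system (shift_space * shift_space) :=
  filter_from (nbhs (1 : S)) (@shift_ent S).

Lemma shift_entourage_filter : Filter shift_entourage.
Proof.
apply: filter_from_filter; first by exists setT; exact: filterT.
move=> V W V1 W1; exists (V `&` W); first exact: filterI.
by move=> p pVW; split; apply: shift_ent_sub pVW => ? [].
Qed.

Lemma shift_entourage_diagonal (A : set (shift_space * shift_space)) :
  shift_entourage A -> diagonal `<=` A.
Proof.
move=> [V /nbhs_singleton V1 VA] [x y] /diagonalP ->; apply: VA.
by exists 1, 1.
Qed.

Lemma shift_entourage_inv (A : set (shift_space * shift_space)) :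
  shift_entourage A -> shift_entourage A^-1%relation.
Proof.
by move=> [V V1 VA]; exists V => // -[x y] /shift_ent_sym; exact: VA.
Qed.

Lemma shift_entourage_split (A : set (shift_space * shift_space)) :
  shift_entourage A -> exists2 B, shift_entourage B & (B \; B)%relation `<=` A.
Proof.
move=> [V V1 VA]; have [W [W1 _ WV]] := nbhs1_sqr ctsM V1.
exists (shift_ent W); first by exists W.
by move=> [x z] /= [y xy yz]; apply: VA; exact: shift_ent_trans xy yz.
Qed.

HB.instance Definition _ := isUniform.Build shift_space shift_entourage_filter
  shift_entourage_diagonal shift_entourage_inv shift_entourage_split.

Lemma nbhs_shift_space (x : shift_space) (A : set shift_space) :
  nbhs x A <-> exists2 V : set S, nbhs (1 : S) V &
    forall y : S, shift_ent V (x : S, y) -> A y.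
Proof.
rewrite -nbhs_entourageE; split.
  move=> [E [V V1 VE] EA]; exists V => // y xy; apply: EA.
  by apply/xsectionP; exact: VE.
move=> [V V1 VA]; exists (shift_ent V); first by exists V.
by move=> y /xsectionP; exact: VA.
Qed.

Lemma countable_shift_uniformity : first_countable S ->
  countable_uniformity shift_space.
Proof.
move=> /(first_countable_base 1)[U [U1 _ U1P]].
apply/countable_uniformityP; exists (fun n => shift_ent (U n)).
  move=> A [V /U1P[n UV] VA]; exists n; apply: subset_trans VA.
  exact: shift_ent_sub.
by move=> n; exists (U n).
Qed.

Hypothesis opS : open_shifts S.

Lemma shift_space_coarser (x : S) (A : set S) :
  @nbhs _ shift_space x A -> nbhs x A.
Proof.
move=> /nbhs_shift_space[V V1 VA].
apply: filterS (nbhs_shift opS x V1) => _ [v Vv <-]; apply: VA.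
by exists v, 1; split => //; [exact: nbhs_singleton|rewrite mulg1].
Qed.

Hypothesis fcS : feebly_compact S.

(** An ultrafilter contains a [V]-ball for every [V]: otherwise one picks
points successively outside the balls of the preceding ones, and these cannot
accumulate. The centres of such balls for a countable base of [V]'s then
accumulate at a limit of the ultrafilter. *)
Lemma shift_space_compact : first_countable S -> compact [set: shift_space].
Proof.
move=> fctS; rewrite compact_ultra => F FU _.
have covered V : nbhs (1 : S) V -> exists x : S, F [set y | shift_ent V (x, y)].
  move=> V1; apply: contrapT => nF.
  have [W [W1 _ WV]] := nbhs1_sqr ctsM V1.
  (* finitely many complements of balls in the ultrafilter have a common point *)
  have avoid (s : seq S) : exists y, forall x, x \in s -> ~ shift_ent V (x, y).
    apply: (@filter_ex _ F _ [set y | forall x, x \in s -> ~ shift_ent V (x, y)]).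
    elim: s => [|x s IHs]; first exact: filterE.
    have /filterS : F (~` [set y | shift_ent V (x, y)]).
      by have [Fx|//] := in_ultra_setVsetC [set y | shift_ent V (x, y)] FU;
        exfalso; apply: nF; exists x.
    move=> Fx; apply: filterS (filterI IHs (Fx _ (fun _ => id))) => y [ys yx] z.
    by rewrite inE => /predU1P[->//|]; exact: ys.
  have [g gP] := choice avoid.
  pose l n := iter n (fun s => g s :: s) [::].
  have gl m n : (m < n)%N -> g (l m) \in l n.
    elim: n => // n IHn; rewrite ltnS leq_eqVlt inE => /predU1P[->|/IHn ->].
      by rewrite eqxx.
    by rewrite orbT.
  have [a aP] := shift_accumulation opS fcS (fun n => g (l n)) (fun _ => W1).
  have [m _ [v [w [Wv Ww xma]]]] := aP _ W1 0%N.
  have [n mn [v' [w' [Wv' Ww' xna]]]] := aP _ W1 m.+1.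
  apply: (gP (l n) (g (l m))); first exact: gl.
  exists (v * w'), (v' * w); split; [exact: WV|exact: WV|rewrite /=].
  by rewrite !mulgA xma xna; exact: mulgRAC.
have [U [U1 Ule U1P]] := first_countable_base 1 fctS.
have /choice[x Fx] n : exists x : S, F [set y | shift_ent (U n) (x, y)].
  exact: covered.
have [a aP] := shift_accumulation opS fcS x U1.
exists a; split => // A /nbhs_shift_space[V V1 VA].
have [W [W1 _ WV]] := nbhs1_sqr ctsM V1.
have [n0 UW] := U1P _ W1.
have [n n0n [v [w [Unv Ww xa]]]] := aP _ W1 n0.
have UnW z : U n z -> W z by move=> /(Ule _ _ n0n)/UW.
apply: filterS (Fx n) => y xy; apply: VA; apply: shift_ent_trans WV _ _.
  by apply: shift_ent_sym; exists v, w; split; [exact: UnW| |exact: xa].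
exact: shift_ent_sub UnW _ xy.
Qed.

Hypothesis cancelS : cancellative S.

(** If [x v = y w] with [v] and [w] small, then [1] is in the closure of [w W],
so [y] is in that of [y w W = x v W]. *)
Lemma shift_ent_closure (U : set S) : nbhs 1 U ->
  exists2 V, nbhs 1 V & forall x y, shift_ent V (x, y) ->
    closure [set x * u | u in U] y.
Proof.
move=> U1; have [W [W1 WU WW]] := nbhs1_sqr ctsM U1.
have [V V1 Vcl] := one_in_closure_shift ctsM opS fcS cancelS W1.
exists (V `&` W); first exact: filterI.
move=> x y [v [w [[_ Wv] [Vw _] /= xy]]] N yN.
have [_ [[u Wu <-] Nywu]] := Vcl _ Vw _ (nbhs_mul1 ctsM yN).
exists (y * (w * u)); split => //; exists (v * u); first exact: WW.
by rewrite !mulgA xy.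
Qed.

Lemma continuous_shift_space (Y : topologicalType) (f : S -> Y) :
  @regular_space Y -> continuous f -> continuous (f : shift_space -> Y).
Proof.
move=> regY ctsf x A /regY[B fxB BA].
have [V V1 Vcl] := shift_ent_closure (nbhs_mul1 ctsM (ctsf (x : S) _ fxB)).
apply/nbhs_shift_space; exists V => // y xy; apply: BA => N fyN.
have [_ [[u Bu <-] Nu]] := Vcl _ _ xy _ (ctsf _ _ fyN).
by exists (f ((x : S) * u)).
Qed.

(** Such functions recover the topology of [shift_space] from maps that are
continuous on [S] and take values in a regular space. *)
Lemma shift_space_separating (R : realType) (x : S) (A : set S) :
  @nbhs _ shift_space x A ->
  exists f : S -> R, [/\ continuous f, f x = 0%R & forall y, ~ A y -> f y = 1%R].
Proof.
move=> xA; pose B : set shift_space := ~` (A : set shift_space)°.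
have clB : closed B by apply: open_closedC; exact: open_interior.
have sep := @uniform_completely_regular R shift_space x B clB (fun h => h xA).
have f0 := @Urysohn_sub0 shift_space R _ _ sep.
have f1 := @Urysohn_sub1 shift_space R _ _ sep.
exists (@Urysohn shift_space R [set x] B); split.
- move=> y N yN; apply: (@shift_space_coarser y).
  exact: (@Urysohn_continuous shift_space R [set x] B y N yN).
- by apply: f0; exists x.
- by move=> y NAy; apply: f1; exists y => // /interior_subset.
Qed.

End ShiftUniformity.

(** * Metrics pulled back along a section *)

Module PullbackMetric.
Section PullbackMetric.
Set Implicit Arguments.
Unset Strict Implicit.
Unset Printing Implicit Defensive.
Import Order.TTheory GRing.Theory Num.Theory.
Local Open Scope classical_set_scope.
Local Open Scope ring_scope.

Context (R : realType) (P : pseudoMetricType R) (C : choiceType) (s : C -> P).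
Hypothesis bounded : forall x y : P, exists2 r : R, 0 < r & ball x r y.
Hypothesis separating : forall c d, close (s c) (s d) -> c = d.

(** A copy of [C] that can carry the metric topology alongside the topology
already present on [C]; boundedness keeps the extended distance finite. *)
Definition pullback_metric : Type := let _ := bounded in let _ := separating in C.

HB.instance Definition _ := Choice.copy pullback_metric C.

Definition pullback_dist (c d : pullback_metric) : R := fine (edist (s c, s d)).

Lemma pullback_distE c d : (pullback_dist c d)%:E = edist (s c, s d).
Proof. by rewrite fineK//; apply/edist_finP; exact: bounded. Qed.

Lemma pullback_distxx c : pullback_dist c c = 0.
Proof. by rewrite /pullback_dist edist_refl. Qed.

Lemma pullback_dist_eq0 c d : pullback_dist c d = 0 -> c = d.
Proof.
by move=> cd0; apply: separating; apply/edist_closeP; rewrite -pullback_distE cd0.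
Qed.

Lemma pullback_dist_sym c d : pullback_dist c d = pullback_dist d c.
Proof. by rewrite /pullback_dist edist_sym. Qed.

Lemma pullback_dist_triangle d c e :
  pullback_dist c e <= pullback_dist c d + pullback_dist d e.
Proof. by rewrite -lee_fin EFinD !pullback_distE; exact: edist_triangle. Qed.

HB.instance Definition _ := @isMetric.Build R pullback_metric pullback_dist
  pullback_distxx pullback_dist_eq0 pullback_dist_sym pullback_dist_triangle.

Lemma nbhs_pullback_metric (c : pullback_metric) (A : set pullback_metric) :
  nbhs c A <-> exists2 N, nbhs (s c) N & s @^-1` N `<=` A.
Proof.
split=> [/nbhs_ballP[e /= e0 eA]|[N /nbhs_ballP[e /= e0 eN] NA]].
  exists (ball (s c) (e / 2)); first by apply: nbhsx_ballx; rewrite divr_gt0.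
  move=> d /= cd; apply: eA; rewrite ballEmdist /=.
  rewrite -lte_fin [X in (X < _)%E]pullback_distE.
  apply: (@le_lt_trans _ _ (e / 2)%:E).
    by apply: edist_fin => //; rewrite divr_gt0.
  by rewrite lte_fin ltr_pdivrMr// ltr_pMr// ltr1n.
apply/nbhs_ballP; exists e => //= d; rewrite ballEmdist /= => cd; apply: NA; apply: eN.
by apply: (@edist_lt_ball _ _ e (s c, s d)); rewrite -pullback_distE lte_fin.
Qed.

End PullbackMetric.
End PullbackMetric.
Import PullbackMetric.

(** * The regular reflection as a quotient of the shift space *)

Section Reflection.
Set Implicit Arguments.
Unset Strict Implicit.
Unset Printing Implicit Defensive.
Import Order.TTheory GRing.Theory Num.Theory numFieldNormedType.Exports.
Local Open Scope classical_set_scope.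
Local Open Scope group_scope.

Context (S : preTopologicalMonoidType).
Hypothesis ctsM : topological_monoid S.
Hypothesis opS : open_shifts S.
Hypothesis cancelS : cancellative S.
Hypothesis mulC : commutative (@monoid.mul S).
Hypothesis fcS : feebly_compact S.
Hypothesis fctS : first_countable S.

Local Notation S_shift := (shift_space ctsM mulC).

Lemma quasi_inverse_shift_ent (x y : S) (V : set S) :
  cluster (nbhs (x * y)) 1 -> nbhs 1 V -> shift_ent V (x * y, 1).
Proof.
move=> xy V1; have [_ [[v Vv <-] Vw]] := xy _ _ (nbhs_shift opS (x * y) V1) V1.
by exists v, (x * y * v); rewrite /= mul1g.
Qed.

Context (C : topologicalType) (phi : S -> C).
Hypothesis reflC : regular_reflection phi.

Lemma regular_reflection_section : exists s : C -> S, cancel s phi.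
Proof.
have [_ _ surj _] := reflC.
have /choice[s sK] (c : C) : exists x, phi x = c.
  by have [x _ <-] := surj c I; exists x.
by exists s.
Qed.

Lemma reflection_shift_continuous : continuous (phi : S_shift -> C).
Proof. by have [[_ regC] ctsphi _ _] := reflC; exact: continuous_shift_space. Qed.

(** A real function separating [x] from the complement of [A] factors through
[phi], and its factor cuts out the required neighbourhood of [phi x]. *)
Lemma reflection_shift_inducing (R : realType) (x : S) (A : set S) :
  @nbhs _ S_shift x A -> exists2 M, nbhs (phi x) M & phi @^-1` M `<=` A.
Proof.
have [_ _ _ univ] := reflC.
move=> /(shift_space_separating opS R)[f [ctsf fx0 fA]].
have [|g [[ctsg gphi] _]] := univ R f _ ctsf.
  by split; [apply: hausdorff_accessible; exact: Rhausdorff|exact: uniform_regular].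
have gE y : g (phi y) = f y by rewrite -gphi.
exists (g @^-1` [set r | (r < 1)%R]).
  apply: ctsg; apply: open_nbhs_nbhs; split; first exact: open_lt.
  by rewrite /= gE fx0 ltr01.
by move=> y /=; rewrite gE => fy1; apply: contrapT => /fA fy; rewrite fy ltxx in fy1.
Qed.

Lemma reflection_eq (x y : S) :
  (forall V, nbhs 1 V -> shift_ent V (x, y)) -> phi x = phi y.
Proof.
have [[T1C _] _ _ _] := reflC.
move=> xy; apply: contrapT => /eqP /T1C[M [oM]]; rewrite !inE => Mx; apply.
have /nbhs_shift_space[V V1 VM] : @nbhs _ S_shift x (phi @^-1` M).
  by apply: reflection_shift_continuous; exact: open_nbhs_nbhs.
by apply: VM; exact: xy.
Qed.

Lemma reflection_compact : compact [set: C].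
Proof.
have [_ _ surj _] := reflC.
have -> : [set: C] = (phi : S_shift -> C) @` [set: S_shift].
  by apply/seteqP; split => // c _; exact: surj.
apply: continuous_compact; last exact: shift_space_compact.
exact/continuous_subspaceT/reflection_shift_continuous.
Qed.

Lemma reflection_metrizable (R : realType) : metrizable R C.
Proof.
have [[T1C _] _ _ _] := reflC; have [s sK] := regular_reflection_section.
pose cu := countable_shift_uniformity ctsM mulC fctS.
pose P : pseudoMetricType R := countable_uniform.type cu.
have bounded (x y : P) : exists2 r : R, (0 < r)%R & ball x r y.
  by exists 2%R; [exact: ltr0n|exact: countable_uniform.countable_uniform_bounded].
have separating (c d : C) : close (s c : P) (s d : P) -> c = d.
  move=> /close_sym /close_cvgxx cvg_cd.
  apply: contrapT => /eqP /T1C[M [oM]]; rewrite !inE => Mc; apply.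
  rewrite -(sK d); apply: (@nbhs_singleton P (s d) (phi @^-1` M)); apply: cvg_cd.
  apply: (reflection_shift_continuous (x := s c)).
  by apply: open_nbhs_nbhs; rewrite /open_nbhs sK.
exists (pullback_metric bounded separating), id, id; split => //.
- move=> c A /nbhs_pullback_metric[N /(reflection_shift_inducing R)[M]].
  rewrite sK => cM MN NA; apply: filterS cM => d Md; apply: NA; apply: MN.
  by rewrite /preimage/= sK.
- move=> c A cA; apply/nbhs_pullback_metric; exists (phi @^-1` A).
    by apply: (reflection_shift_continuous (x := s c)); rewrite sK.
  by move=> d /=; rewrite sK.
Qed.

End Reflection.

(** * The group structure on the regular reflection *)

Section ReflectionGroup.
Set Implicit Arguments.
Unset Strict Implicit.
Unset Printing Implicit Defensive.
Local Open Scope classical_set_scope.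
Local Open Scope group_scope.

Context (R : realType) (S : preTopologicalMonoidType).
Hypothesis ctsM : topological_monoid S.
Hypothesis opS : open_shifts S.
Hypothesis cancelS : cancellative S.
Hypothesis mulC : commutative (@monoid.mul S).
Hypothesis fcS : feebly_compact S.
Hypothesis fctS : first_countable S.

Context (C : preTopologicalMonoidType) (phi : S -> C).
Hypothesis reflC : regular_reflection phi.
Hypothesis phiM : monoid_morphism phi.

Let phi_cts := @reflection_shift_continuous S ctsM opS cancelS mulC fcS C phi reflC.
Let phi_ind := @reflection_shift_inducing S ctsM opS mulC C phi reflC R.

Lemma reflection_topological_monoid : topological_monoid C.
Proof.
have [s sK] := regular_reflection_section reflC.
move=> [c d] N /=; rewrite -{1}(sK c) -{1}(sK d) -phiM.2 => cdN.
have /nbhs_shift_space[V V1 VN] := phi_cts cdN.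
have [W [W1 _ WV]] := nbhs1_sqr ctsM V1.
have near x : exists2 M, nbhs (phi x) M & forall y, M (phi y) -> shift_ent W (x, y).
  by apply: phi_ind; apply/nbhs_shift_space; exists W.
have [M1 cM1 M1W] := near (s c); have [M2 dM2 M2W] := near (s d).
exists (M1, M2); first by rewrite /= -{1}(sK c) -{1}(sK d).
move=> [c' d'] /= []; rewrite -(sK c') -(sK d') -phiM.2.
move=> /M1W cc' /M2W dd'; apply: VN.
apply: (shift_ent_trans mulC WV (y := s c' * s d)); last exact: shift_ent_mul.
by rewrite (mulC (s c)) (mulC (s c')); exact: shift_ent_mul.
Qed.

(** Quasi-inversion [q] is uniformly continuous on [shift_space] by invariance:
if [y] is near [x] then [q x] is near [q x * q y * y], which is near
[q x * q y * x], which is near [q y]. *)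
Lemma reflection_topological_group : topological_group C.
Proof.
have [s sK] := regular_reflection_section reflC.
split; first exact: reflection_topological_monoid.
have /choice[q qP] := quasi_inverse ctsM opS fcS cancelS mulC fctS.
have xq x V : nbhs 1 V -> shift_ent V (x * q x, 1).
  exact: quasi_inverse_shift_ent.
have phixq x : phi x * phi (q x) = 1.
  rewrite -phiM.1 -phiM.2.
  by apply: (reflection_eq ctsM opS cancelS mulC fcS reflC) => V; exact: xq.
have phiqx x : phi (q x) * phi x = 1 by rewrite -phiM.2 mulC phiM.2.
exists (fun c => phi (q (s c))); split.
- by move=> c; rewrite -{2}(sK c).
- by move=> c; rewrite -{1}(sK c).
move=> c N cN; set x := s c.
have /nbhs_shift_space[V V1 VN] := phi_cts cN.
have [W' [W'1 _ W'V]] := nbhs1_sqr ctsM V1.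
have [W [W1 WW' WW]] := nbhs1_sqr ctsM W'1.
have [M cM MW] : exists2 M, nbhs (phi x) M & forall y, M (phi y) -> shift_ent W (x, y).
  by apply: phi_ind; apply/nbhs_shift_space; exists W.
rewrite -(sK c); apply: filterS cM => d; rewrite -{1}(sK d) => /MW /shift_ent_sym yx.
set y := s d in yx *; apply: VN.
have x_xyy : shift_ent W (q x, q x * q y * y).
  apply: shift_ent_sym; rewrite -mulgA (mulC (q y)) -{2}(mulg1 (q x)).
  by apply: shift_ent_mul; exact: xq.
have xyx_y : shift_ent W (q x * q y * x, q y).
  rewrite (mulC (q x)) -mulgA (mulC (q x)) -{2}(mulg1 (q y)).
  by apply: shift_ent_mul; exact: xq.
apply: (shift_ent_trans mulC W'V (y := q x * q y * x)).
  exact: (shift_ent_trans mulC WW x_xyy (shift_ent_mul _ yx)).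
exact: shift_ent_sub WW' _ xyx_y.
Qed.

End ReflectionGroup.

Lemma regular_reflection_id (S : topologicalType) :
  T1_regular S -> @regular_reflection S S id.
Proof.
move=> regS; split.
- exact: regS.
- by move=> x A.
- by move=> x _; exists x.
- by move=> Y f _ ctsf; exists f; split => // g [_ gE]; rewrite -gE.
Qed.

Theorem theorem3p11 (R : realType) (S : preTopologicalMonoidType)
    (S_topological_monoid : topological_monoid S)
    (S_open_shifts : open_shifts S)
    (S_cancellative : cancellative S)
    (S_commutative : commutative (@monoid.mul S))
    (S_feebly_compact : feebly_compact S)
    (S_first_countable : first_countable S) :
  [/\ forall (C : preTopologicalMonoidType) (phi : S -> C),
        regular_reflection phi -> monoid_morphism phi ->
        compact_metrizable_topological_group R C,
      hausdorff_space S -> paratopological_group S &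
      T1_regular S -> compact_metrizable_topological_group R S].
Proof.
have reflP (C : preTopologicalMonoidType) (phi : S -> C) :
    regular_reflection phi -> monoid_morphism phi ->
    compact_metrizable_topological_group R C.
  move=> reflC phiM; split.
  - exact: reflection_compact reflC.
  - exact: reflection_metrizable reflC _.
  - exact: (reflection_topological_group R) reflC phiM.
split=> // [hS|regS].
  split => //.
  have /choice[q qP] : forall x, exists y, cluster (nbhs (x * y)%g) (1%g : S).
    exact: quasi_inverse.
  exists q; split=> x; last exact/hS.
  by rewrite S_commutative; exact/hS.
by apply: (reflP S id) => //; exact: regular_reflection_id.
Qed.
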